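(* Fix $r\in\mathbb N$ and let $\mathscr C$ be a class of graphs such that every graph in the elementary closure $\overline{\mathscr C}$ of $\mathscr C$ is $r$-separable. Then there exists $k\in\mathbb N$ such that Separator wins the Separation game of radius $r$ in $k$ rounds on every $G\in\mathscr C$.
   Context: Graphs are simple, possibly infinite. The elementary closure $\overline{\mathscr C}$ is the class of all models of the theory of $\mathscr C$ (the set of first-order sentences true in all graphs of $\mathscr C$). $N$ is an elementary extension of $M$ if $V(M)\subseteq V(N)$ and $M\models\phi(\bar m)\iff N\models\phi(\bar m)$ for all formulas $\phi$ and tuples $\bar m$ from $M$. For finite $S\subseteq V(H)$, the $S$-classes partition $V(H)$: two vertices are in the same class iff they are equal or both lie outside $S$ and have the same neighbours in $S$; an $S$-flip of $H$ is obtained by choosing a set of unordered pairs $\{P,Q\}$ of $S$-classes ($P=Q$ allowed) and complementing adjacency between all distinct $u\in P,w\in Q$. A graph $M$ is $r$-separable if for every elementary extension $N$ of $M$ and every $v\in V(N)\setminus V(M)$ there is a finite $S\subseteq V(M)$ and an $S$-flip $N'$ of $N$ with $\mathrm{dist}_{N'}(v,u)>r$ for all $u\in V(M)$. Vertices $w,c$ of $G$ are $r$-separated over $S$ if some $S$-flip $G'$ of $G$ has $\mathrm{dist}_{G'}(w,c)>r$. Separation game of radius $r$ on $G$: $A_0=V(G)$, $S_0=\emptyset$; in round $k\ge1$: if $|A_{k-1}|=1$ Separator wins; otherwise Connector picks $c_k\in A_{k-1}$ and $A_k:=A_{k-1}\setminus\{w: w,c_k$ are $r$-separated over $S_{k-1}$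 in $G\}$; then Separator picks $s_k\in V(G)$ and $S_k:=S_{k-1}\cup\{s_k\}$. *)

(* Defs.v *)
From mathcomp Require Import all_boot.
From mathcomp Require Import boolp classical_sets functions cardinality.

Set Implicit Arguments.
Unset Strict Implicit.
Unset Printing Implicit Defensive.

Local Open Scope classical_set_scope.

Record graph := Graph {
  vert :> Type;
  adj : vert -> vert -> Prop;
  adj_sym : forall u v, adj u v -> adj v u;
  adj_irr : forall u, ~ adj u u }.

(* First-order formulas in the language of graphs, with free variables among  *)
(* x_0, ..., x_(n-1).  [Ex] binds variable 0 of its body.  Since a sentence   *)
(* is a [formula 0], satisfaction also makes sense in the empty graph.        *)
Inductive formula (n : nat) : Type :=
| Eq of 'I_n & 'I_n
| Adj of 'I_n & 'I_n
| Not of formula n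
| And of formula n & formula n
| Ex of formula n.+1.

Definition env_cons (V : Type) (n : nat) (x : V) (e : 'I_n -> V)
  (i : 'I_n.+1) : V := if unlift ord0 i is Some j then e j else x.

Fixpoint sat (G : graph) (n : nat) (phi : formula n) : ('I_n -> G) -> Prop :=
  match phi with
  | Eq i j => fun e => e i = e j
  | Adj i j => fun e => adj (e i) (e j)
  | Not p => fun e => ~ sat p e
  | And p q => fun e => sat p e /\ sat q e
  | Ex p => fun e => exists x : G, sat p (env_cons x e)
  end.

Definition no_var (V : Type) (i : 'I_0) : V :=
  False_rect V (notF (ltn_ord i)).

Definition models (G : graph) (phi : formula 0) : Prop :=
  sat phi (@no_var G).

(* Classes of graphs are written [graph -> Prop] rather than [set graph] to   *)
(* keep the universe of [graph] independent of the one of [set].              *)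
Definition theory (C : graph -> Prop) (phi : formula 0) : Prop :=
  forall G, C G -> models G phi.

Definition elementary_closure (C : graph -> Prop) (M : graph) : Prop :=
  forall phi, theory C phi -> models M phi.

(* N is an elementary extension of M, the inclusion of V(M) in V(N) being     *)
(* the map f (injective, as f preserves and reflects the formula x_0 = x_1).  *)
Definition elementary (M N : graph) (f : M -> N) : Prop :=
  forall (n : nat) (phi : formula n) (e : 'I_n -> M),
    sat phi e <-> sat phi (fun i => f (e i)).

Fixpoint walk (G : graph) (n : nat) (u v : G) : Prop :=
  if n is m.+1 then exists w, adj u w /\ walk m w v else u = v.

(* [None] stands for an infinite distance. *)
Definition dist (G : graph) (u v : G) : option nat :=
  match pselect (exists n, `[< walk n u v >]) with
  | left uv => Some (ex_minn uv)
  | right _ => None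
  end.

Definition dist_gt (G : graph) (u v : G) (r : nat) : Prop :=
  if dist u v is Some d then r < d else True.

Definition same_class (G : graph) (S : set G) (u w : G) : Prop :=
  u = w \/ [/\ ~ S u, ~ S w & forall s, S s -> (adj u s <-> adj w s)].

Definition class_of (G : graph) (S : set G) (u : G) : set G :=
  [set w | same_class S u w].

(* The unordered pair {P, Q} is the set [set P; Q], so F below is a set of    *)
(* unordered pairs; members of F that are not pairs of S-classes play no role.*)
Definition flip_adj (G : graph) (S : set G) (F : set (set (set G)))
  (u w : G) : Prop :=
  u <> w /\ (adj u w <-> ~ F [set class_of S u; class_of S w]).

Lemma flip_adj_sym (G : graph) (S : set G) (F : set (set (set G))) (u w : G) :
  flip_adj S F u w -> flip_adj S F w u.
Proof.
move=> [uw H]; split; first by move=> wu; apply: uw.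
rewrite setUC; split.
- by move=> wu; apply/H; apply: adj_sym.
- by move=> nF; apply: adj_sym; apply/H.
Qed.

Lemma flip_adj_irr (G : graph) (S : set G) (F : set (set (set G))) (u : G) :
  ~ flip_adj S F u u.
Proof. by case. Qed.

(* The S-flips of G are the graphs [flip S F], for F arbitrary. *)
Definition flip (G : graph) (S : set G) (F : set (set (set G))) : graph :=
  Graph (@flip_adj_sym G S F) (@flip_adj_irr G S F).

Definition separable (r : nat) (M : graph) : Prop :=
  forall (N : graph) (f : M -> N), elementary f ->
  forall v : N, ~ range f v ->
  exists S : set M, finite_set S /\
  exists F : set (set (set N)),
    forall u : M, @dist_gt (flip (f @` S) F) v (f u) r.

Definition separated_over (G : graph) (r : nat) (S : set G) (w c : G) : Prop :=
  exists F : set (set (set G)), @dist_gt (flip S F) w c r.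

(* Separator has a strategy ensuring a win at the start of one of the next k  *)
(* rounds, from the position (A, S).  On the empty graph Connector has no     *)
(* legal first move, which counts as a win for Separator.                     *)
Fixpoint wins_from (G : graph) (r k : nat) (A S : set G) : Prop :=
  if k is k'.+1 then
    (exists a, A = [set a]) \/
    (forall c, A c -> exists s : G,
       wins_from r k' (A `\` [set w | separated_over r S w c]) (S `|` [set s]))
  else False.

Definition separator_wins (r k : nat) (G : graph) : Prop :=
  @wins_from G r k setT set0.

(* Main.v *)
Require Import Defs.
From mathcomp Require Import all_boot.
From mathcomp Require Import boolp classical_sets functions cardinality filter.

(* Suppose that for every k some G_k in C lets Connector survive k + 2 rounds.
   Let Separator play there so that she copies every vertex c_i of Connector and
   supplies witnesses for all existential formulas over her own vertices s_j.
   In a nonprincipal ultraproduct N of the G_k, the classes of the s_j form an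
   elementary substructure M by the Tarski-Vaught test, so M is r-separable by
   Los's theorem.  Let w_k be a vertex that survives in G_k and differs from
   Connector's last vertex.  The class v of (w_k) is not in M, because a vertex
   of S is separated over S from all others.  Hence a flip of N over finitely
   many s_j, j < J, puts v at distance more than r from M, in particular from
   the class of c_J.  This flip is given by a relation between adjacency types
   over (s_j), j < J, so it transfers to almost all G_k and separates w_k from
   c_J there, contradicting the survival of w_k. *)

Set Implicit Arguments.
Unset Strict Implicit.
Unset Printing Implicit Defensive.

Local Open Scope classical_set_scope.

(** * Walks and flips *)

(** Walks of length at most [n], defined by recursion so that a bound on distance can be transferred
    between graphs by induction on [n]. *)
Fixpoint reach (G : graph) (n : nat) (u v : G) : Prop :=
  if n is m.+1 then u = v \/ exists w, adj u w /\ reach m w v else u = v.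

Lemma walk_reach (G : graph) (d n : nat) (u v : G) :
  d <= n -> walk d u v -> reach n u v.
Proof.
elim: d n u => [|d IH] [|n] u //= dn; first by move=> ->; left.
by move=> [w [uw wv]]; right; exists w; split=> //; apply: IH wv.
Qed.

Lemma reach_walk (G : graph) (n : nat) (u v : G) :
  reach n u v -> exists2 d, d <= n & walk d u v.
Proof.
elim: n u => [|n IH] u /= => [uv|[uv|[w [uw /IH[d dn wv]]]]].
- by exists 0.
- by exists 0.
- by exists d.+1 => //=; exists w.
Qed.

Lemma dist_gtE (G : graph) (u v : G) (r : nat) :
  dist_gt u v r <-> ~ reach r u v.
Proof.
rewrite /dist_gt /dist; case: pselect => [uv|nuv].
- case: ex_minnP => d /asboolP duv dmin; split=> [rd /reach_walk[e er euv]|nr].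
  + by have := dmin e (asboolT euv); rewrite leqNgt (leq_ltn_trans er rd).
  + by rewrite ltnNge; apply/negP => dr; apply: nr; apply: walk_reach duv.
- split=> // _ /reach_walk[d _ duv]; apply: nuv; exists d; exact/asboolP.
Qed.

(** An element of [S] agrees only with itself on equalities over [S], so both clauses of
    [same_class] merge into agreement on atomic formulas over [S]. *)
Lemma same_classP (G : graph) (S : set G) (u w : G) :
  same_class S u w <->
  forall s, S s -> (u = s <-> w = s) /\ (adj u s <-> adj w s).
Proof.
split=> [[->//|[nSu nSw a]] s Ss|H].
  by split; [split=> E; move: Ss; rewrite -E|exact: a].
have [Su|nSu] := pselect (S u); first by left; apply/esym/(H u Su).1.
have [Sw|nSw] := pselect (S w); first by left; apply/(H w Sw).1.
by right; split=> // s /H[].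
Qed.

Lemma class_of_eq (G : graph) (S : set G) (u w : G) :
  class_of S u = class_of S w <-> same_class S u w.
Proof.
split=> [E|/same_classP uw].
  have : class_of S w w by left.
  by rewrite -E.
apply/seteqP; split=> x /same_classP H; apply/same_classP => s Ss.
  by rewrite -(uw s Ss).1 -(uw s Ss).2; exact: H.
by rewrite (uw s Ss).1 (uw s Ss).2; exact: H.
Qed.

Lemma set2_inj (T : Type) (a b c d : T) :
  [set a; b] = [set c; d] -> (a = c /\ b = d) \/ (a = d /\ b = c).
Proof.
move=> E.
have ha : [set c; d] a by rewrite -E; left.
have hb : [set c; d] b by rewrite -E; right.
have hc : [set a; b] c by rewrite E; left.
have hd : [set a; b] d by rewrite E; right.
by move: ha hb hc hd {E} => [] /= ? [] /= ? [] /= ? [] /= ?; subst; auto.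
Qed.

(* The flip that toggles the pairs ({w}, class of q), for q adjacent to w,
   isolates w. *)
Lemma separated_over_mem (G : graph) (r : nat) (S : set G) (w c : G) :
  S w -> w <> c -> separated_over r S w c.
Proof.
move=> Sw wc.
exists [set P | exists2 q, adj w q & P = [set class_of S w; class_of S q]].
apply/dist_gtE; case: r => [|r] //= -[//|[q [[wq]]]] /= fl _.
have adjF : (exists2 q', adj w q' & [set class_of S w; class_of S q] =
    [set class_of S w; class_of S q']) <-> adj w q; last by move: fl adjF; tauto.
split=> [[q' wq' E]|]; last by exists q.
have {}E := set2_inj E.
have /class_of_eq/same_classP qq' : class_of S q = class_of S q'.
  by case: E => -[] // -> ->.
by apply: adj_sym; apply/(qq' w Sw).2; exact: adj_sym.
Qed.

(** * Profiles over finitely many vertices *)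

Definition initial (T : Type) (s : nat -> T) (J : nat) : set T :=
  [set x | exists2 l, l < J & s l = x].

Lemma initial0 (T : Type) (s : nat -> T) : initial s 0 = set0.
Proof. by apply/seteqP; split=> x //= -[]. Qed.

(** The atomic type over [s 0], ..., [s (J - 1)]. Its values lie in a finite type independent of
    [G], so types in different graphs can be compared. *)
Definition profile (G : graph) (J : nat) (s : nat -> G) (u : G) :
    {ffun 'I_J -> bool * bool} :=
  [ffun l : 'I_J => (`[< u = s l >], `[< adj u (s l) >])].

Lemma profileP (G : graph) (J : nat) (s : nat -> G) (u w : G) :
  profile J s u = profile J s w <-> same_class (initial s J) u w.
Proof.
rewrite same_classP; split=> [/ffunP E x [l lJ <-]|E].
  have := E (Ordinal lJ); rewrite !ffunE /= => -[e1 e2].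
  by split; [exact: asbool_eq_equiv e1|exact: asbool_eq_equiv e2].
apply/ffunP => l; rewrite !ffunE.
have [|e1 e2] := E (s l); first by exists l.
by congr pair; apply/asbool_equiv_eq.
Qed.

(** Vertices of equal profile lie in the same [S]-class, so [F] induces a relation on profiles; it
    is symmetric because pairs are unordered. *)
Lemma flip_profile (G : graph) (J : nat) (s : nat -> G) (S : set G)
    (F : set (set (set G))) : S `<=` initial s J ->
  exists2 R : {ffun 'I_J -> bool * bool} -> {ffun 'I_J -> bool * bool} -> Prop,
    forall t t', R t t' -> R t' t &
    forall u w, F [set class_of S u; class_of S w] <->
                R (profile J s u) (profile J s w).
Proof.
move=> SJ.
have cl u w : profile J s u = profile J s w -> class_of S u = class_of S w.
  move=> /profileP/same_classP E; apply/class_of_eq/same_classP => x /SJ.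
  exact: E.
exists (fun t t' => exists u w, [/\ profile J s u = t, profile J s w = t' &
          F [set class_of S u; class_of S w]]).
  by move=> t t' [u [w [ut wt Fuw]]]; exists w, u; rewrite setUC.
move=> u w; split=> [Fuw|[u' [w' [/cl eu /cl ew]]]]; first by exists u, w.
by rewrite eu ew.
Qed.

Lemma profile_flip (G : graph) (J : nat) (s : nat -> G)
    (R : {ffun 'I_J -> bool * bool} -> {ffun 'I_J -> bool * bool} -> Prop) :
  (forall t t', R t t' -> R t' t) ->
  exists F : set (set (set G)), forall u w,
    F [set class_of (initial s J) u; class_of (initial s J) w] <->
    R (profile J s u) (profile J s w).
Proof.
move=> Rsym; set S := initial s J.
exists [set P | exists u w, P = [set class_of S u; class_of S w] /\
                  R (profile J s u) (profile J s w)] => u w /=.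
have cl x y : class_of S x = class_of S y -> profile J s x = profile J s y.
  by move=> /class_of_eq/profileP.
split=> [[u' [w' [E]]]|Ruw]; last by exists u, w.
have {}E := set2_inj E.
by case: E => -[/cl -> /cl ->] //; exact: Rsym.
Qed.

(** * Ultraproducts *)

Lemma ultra_not (T : Type) (U : set_system T) (A : set T) :
  UltraFilter U -> U (~` A) <-> ~ U A.
Proof.
move=> UU; have PU : ProperFilter U := ultra_proper; split=> [UnA UA|nUA].
  by have [x []] := filter_ex (filterI UA UnA).
by case: (in_ultra_setVsetC A UU).
Qed.

Section Ultraproduct.
Variables (U : set_system nat) (UU : UltraFilter U) (G : nat -> graph).

Let PU : ProperFilter U := ultra_proper.

Definition ultra_eq (f g : forall k, G k) : Prop := U [set k | f k = g k].

(** An equivalence class is the predicate it defines, so equality of classes follows from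
    extensionality. *)
Definition ultra_vert : Type :=
  {P : (forall k, G k) -> Prop | exists f, P = ultra_eq f}.

Definition ultra_class (f : forall k, G k) : ultra_vert :=
  exist _ (ultra_eq f) (ex_intro _ f erefl).

Lemma ultra_class_surj (x : ultra_vert) : exists f, x = ultra_class f.
Proof. by case: x => P [f Pf]; exists f; exact: eq_exist. Qed.

Lemma ultra_classP (f g : forall k, G k) :
  ultra_class f = ultra_class g <-> U [set k | f k = g k].
Proof.
split=> [/(congr1 sval) /= E|fg].
  suff : ultra_eq f g by [].
  by rewrite E; apply: filterS filterT.
apply: eq_exist; apply/funext => h; apply/propext.
by split; apply: filterS2 fg => k /= ->.
Qed.

Definition ultra_adj (x y : ultra_vert) : Prop :=
  exists f g, [/\ x = ultra_class f, y = ultra_class g &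
                  U [set k | adj (f k) (g k)]].

Lemma ultra_adj_sym (x y : ultra_vert) : ultra_adj x y -> ultra_adj y x.
Proof.
move=> [f [g [xf yg fg]]]; exists g, f; split=> //.
by apply: filterS fg => k /= /adj_sym.
Qed.

Lemma ultra_adj_irr (x : ultra_vert) : ~ ultra_adj x x.
Proof.
move=> [f [g [-> /ultra_classP fg afg]]].
have [k [/= fgk]] := filter_ex (filterI fg afg).
by rewrite fgk => /adj_irr.
Qed.

Definition ultraproduct : graph := Graph ultra_adj_sym ultra_adj_irr.

Lemma adj_ultraP (f g : forall k, G k) :
  @adj ultraproduct (ultra_class f) (ultra_class g) <->
  U [set k | adj (f k) (g k)].
Proof.
split=> [[f' [g' [/ultra_classP ff' /ultra_classP gg' a]]]|]; last first.
  by exists f, g.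
by apply: filterS (filterI (filterI ff' gg') a) => k /= [[-> ->]].
Qed.

Lemma env_cons_comp (A B : Type) (h : A -> B) (n : nat) (x : A)
    (e : 'I_n -> A) (i : 'I_n.+1) :
  h (env_cons x e i) = env_cons (h x) (h \o e) i.
Proof. by rewrite /env_cons; case: unlift. Qed.

(** [x0] supplies a value at the indices without a witness, where a factor could otherwise be
    empty. *)
Lemma los (x0 : forall k, G k) (n : nat) (phi : formula n) (e : 'I_n -> forall k, G k) :
  @sat ultraproduct n phi (ultra_class \o e) <->
  U [set k | sat phi (fun i => e i k)].
Proof.
elim: phi e => {n} [n i j|n i j|n p IH|n p IHp q IHq|n p IH] e /=.
- exact: ultra_classP.
- exact: adj_ultraP.
- by rewrite IH -ultra_not.
- rewrite IHp IHq; split=> [[]|]; first exact: filterI.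
  by move=> pq; split; apply: filterS pq => k [].
- have envE (f : forall k, G k) k : (fun i => env_cons f e i k) =
      env_cons (f k) (fun i => e i k).
    by apply/funext => i; exact: (env_cons_comp (fun g : forall k, G k => g k)).
  have clE f : ultra_class \o env_cons f e =
      env_cons (ultra_class f) (ultra_class \o e).
    by apply/funext => i; exact: env_cons_comp.
  split=> [[x]|H].
    have [f ->] := ultra_class_surj x; rewrite -clE => /IH.
    by apply: filterS => k /=; rewrite envE => ?; exists (f k).
  have Hf k : exists x, (exists y, sat p (env_cons y (fun i => e i k))) ->
      sat p (env_cons x (fun i => e i k)).
    have [[y py]|ny] := pselect (exists y, sat p (env_cons y (e^~ k))).
      by exists y.
    by exists (x0 k).
  pose f k := sval (cid (Hf k)).
  exists (ultra_class f); rewrite -clE; apply/IH.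
  by apply: filterS H => k /= /(svalP (cid (Hf k))); rewrite envE.
Qed.

Lemma ultra_asbool (P : nat -> Prop) (Q : Prop) :
  (Q <-> U [set k | P k]) -> U [set k | `[< P k >] = `[< Q >]].
Proof.
move=> QP; have [HQ|nQ] := pselect Q.
  apply: filterS (QP.1 HQ) => k /= Pk; exact: asbool_equiv_eq.
have UnP : U (~` [set k | P k]) by apply/ultra_not => /QP.
by apply: filterS UnP => k /= nPk; exact: asbool_equiv_eq.
Qed.

Variables (s : nat -> forall k, G k) (J : nat).

(** Each of the finitely many entries of the profile is decided by the ultrafilter, and a filter is
    closed under finite intersections. *)
Lemma profile_ultra (f : forall k, G k) :
  U [set k | profile J (s^~ k) (f k) =
             @profile ultraproduct J (ultra_class \o s) (ultra_class f)].
Proof.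
have Hl (l : 'I_J) : U [set k |
    (`[< f k = s l k >], `[< adj (f k) (s l k) >]) =
    (`[< ultra_class f = ultra_class (s l) >],
     `[< @adj ultraproduct (ultra_class f) (ultra_class (s l)) >])].
  apply: filterS2 (ultra_asbool (ultra_classP f (s l)))
    (ultra_asbool (adj_ultraP f (s l))) => k /= -> -> //.
apply: filterS (filter_forall _ Hl) => k H.
by apply/ffunP => l; rewrite !ffunE; exact: H.
Qed.

(** The relation on profiles behind [F] defines a flip of each factor. Short walks in almost all of
    these flips are glued, vertex by vertex, into a walk in the flip of the ultraproduct. *)
Lemma not_separated_ultra (r : nat) (S : set ultraproduct)
    (F : set (set (set ultraproduct))) (f g : forall k, G k) :
  S `<=` @initial ultraproduct (ultra_class \o s) J ->
  U [set k | ~ separated_over r (initial (s^~ k) J) (f k) (g k)] ->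
  ~ @dist_gt (flip S F) (ultra_class f) (ultra_class g) r.
Proof.
move=> SJ nsep; have [R Rsym FR] := flip_profile F SJ.
pose Fk k := sval (cid (profile_flip (s^~ k) Rsym)).
have FkR k : forall u w, Fk k [set class_of _ u; class_of _ w] <-> _ :=
  svalP (cid (profile_flip (s^~ k) Rsym)).
pose H k := flip (initial (s^~ k) J) (Fk k).
have adjH f1 f2 : U [set k | @adj (H k) (f1 k) (f2 k)] ->
    @adj (flip S F) (ultra_class f1) (ultra_class f2).
  move=> a; split.
    move=> /ultra_classP E; have [k [/= e [ne _]]] := filter_ex (filterI E a).
    exact: ne.
  rewrite FR adj_ultraP.
  have p : U [set k | @adj (H k) (f1 k) (f2 k) /\
      (R (profile J (s^~ k) (f1 k)) (profile J (s^~ k) (f2 k)) <->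
       R (@profile ultraproduct J (ultra_class \o s) (ultra_class f1))
         (@profile ultraproduct J (ultra_class \o s) (ultra_class f2)))].
    by apply: filterS3 a (profile_ultra f1) (profile_ultra f2) => k /= ? -> ->.
  split=> [b|nR].
    have [k [[[_ /=]]]] := filter_ex (filterI p b).
    by rewrite FkR => abR <- /= /abR.
  by apply: filterS p => k /= -[[_ /=]]; rewrite FkR => -> ->.
suff reachH n f1 : U [set k | @reach (H k) n (f1 k) (g k)] ->
    @reach (flip S F) n (ultra_class f1) (ultra_class g).
  move=> /dist_gtE; apply; apply: reachH; apply: filterS nsep => k /= nk.
  apply: contrapT => nr; apply: nk; exists (Fk k); exact/dist_gtE.
elim: n f1 => [|n IH] f1 /= h; first exact/ultra_classP.
(* The ultrafilter decides whether the walks stop here or take another step. *)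
have [fg|/(ultra_not _ UU).2 nfg] := pselect (U [set k | f1 k = g k]).
  by left; apply/ultra_classP.
right.
(* The next vertex is needed at every index; [f1 k] is the default where no step is taken. *)
have Hw k : exists w : H k, f1 k = g k \/ ~ @reach (H k) n.+1 (f1 k) (g k) \/
    @adj (H k) (f1 k) w /\ @reach (H k) n w (g k).
  have [[e|[w ww]]|nr] := pselect (@reach (H k) n.+1 (f1 k) (g k)).
  - by exists (f1 k); left.
  - by exists w; right; right.
  - by exists (f1 k); right; left.
pose w k : G k := sval (cid (Hw k)).
have ww : U [set k | @adj (H k) (f1 k) (w k) /\ @reach (H k) n (w k) (g k)].
  apply: filterS2 nfg h => k /= ne rk.
  by have [//|[/(_ rk)//|]] := svalP (cid (Hw k)).
exists (ultra_class w); split; [apply: adjH|apply: IH].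
all: by apply: filterS ww => k [].
Qed.

End Ultraproduct.

(** * The Tarski-Vaught test *)

Section Induced.
Variables (N : graph) (D : N -> Prop).

Definition induced_adj (x y : {x : N | D x}) : Prop := adj (sval x) (sval y).

Lemma induced_adj_sym (x y : {x : N | D x}) :
  induced_adj x y -> induced_adj y x.
Proof. exact: adj_sym. Qed.

Lemma induced_adj_irr (x : {x : N | D x}) : ~ induced_adj x x.
Proof. exact: adj_irr. Qed.

Definition induced : graph := Graph induced_adj_sym induced_adj_irr.

Definition induced_val (x : induced) : N := sval x.

Lemma tarski_vaught :
  (forall n (phi : formula n.+1) (e : 'I_n -> induced),
     (exists x : N, sat phi (env_cons x (induced_val \o e))) ->
     exists y : induced,
       sat phi (env_cons (induced_val y) (induced_val \o e))) ->
  elementary induced_val.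
Proof.
move=> TV n phi.
elim: phi => {n} [n i j|n i j|n p IH|n p IHp q IHq|n p IH] e /=.
- split=> [-> //|]; rewrite /induced_val.
  by case: (e i) (e j) => [x Dx] [y Dy] /= xy; exact: eq_exist.
- by [].
- by rewrite IH.
- by rewrite IHp IHq.
- have envE y : (fun i => induced_val (env_cons y e i)) =
      env_cons (induced_val y) (induced_val \o e).
    by apply/funext => i; exact: env_cons_comp.
  split=> [[y /IH]|/TV[y py]]; first by rewrite envE; exists (induced_val y).
  by exists y; apply/IH; rewrite envE.
Qed.

End Induced.

(** * Plays against a fixed strategy of Separator *)

Definition scons (T : Type) (x : T) (f : nat -> T) (n : nat) : T :=
  if n is m.+1 then f m else x.

(* In round i Separator knows the vertices c 0, ..., c i played by Connector
   and her own previous vertices s 0, ..., s (i - 1). *)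
Definition causal (T : Type) (st : nat -> (nat -> T) -> (nat -> T) -> T) :=
  forall i c s c' s', (forall j, j <= i -> c j = c' j) ->
    (forall j, j < i -> s j = s' j) -> st i c s = st i c' s'.

(** Connector has a move that defeats every answer, in particular the one given by [st]; iterating
    this produces the play. Of the [k.+2] rounds, the last only shows that the remaining set is
    neither empty nor a singleton, whence [w <> c k]. *)
Lemma connector_play (G : graph) (r k : nat) (A S : set G)
    (st : nat -> (nat -> G) -> (nat -> G) -> G) :
  causal st -> ~ wins_from r k.+2 A S ->
  exists (c s : nat -> G) (w : G),
    [/\ A w, forall i, i <= k -> s i = st i c s,
        forall i, i <= k -> ~ separated_over r (S `|` initial s i) w (c i) &
        w <> c k].
Proof.
elim: k A S st => [|k IH] A S st cst.
  move=> /not_orP[_ /existsNP[c /not_implyP[Ac /forallNP/(_ c)]]].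
  move=> /not_orP[nA' /existsNP[c' /not_implyP[A'c' _]]].
  set A' := A `\` _ in nA' A'c'.
  have [w [[Aw nsep] wc]] : exists w, A' w /\ w <> c.
    apply: contrapT => /forallNP H; apply: nA'; exists c.
    have A'c x : A' x -> x = c.
      by move=> A'x; apply: contrapT => xc; apply: (H x).
    by apply/seteqP; split=> x /= => [/A'c //|->]; rewrite -(A'c _ A'c').
  (* Only round 0 is constrained; there [st] reads [c 0] alone, so constant histories serve. *)
  exists (fun=> c), (fun i => st i (fun=> c) (fun=> c)), w; split=> //.
    by move=> i; rewrite leqn0 => /eqP ->; apply: cst.
  move=> i; rewrite leqn0 => /eqP ->.
  by rewrite initial0 setU0.
move=> /not_orP[_ /existsNP[c0 /not_implyP[Ac0 /forallNP]]].
pose s0 := st 0 (fun=> c0) (fun=> c0); move=> /(_ s0).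
(* The rest of the play follows [st] with the first round prepended to both histories. *)
pose st' i c s := st i.+1 (scons c0 c) (scons s0 s).
move=> /(IH _ _ st')[|c [s [w [[Aw nsep0] sE nsep wc]]]].
  move=> i c s c' s' cc' ss'; apply: cst => -[|j] //=.
    exact: cc'.
  exact: ss'.
exists (scons c0 c), (scons s0 s), w; split=> //.
  move=> [|i] //= ik; last exact: sE.
  by apply: cst => -[].
move=> [|i] /= ik; first by rewrite initial0 setU0.
suff -> : S `|` initial (scons s0 s) i.+1 = S `|` [set s0] `|` initial s i.
  exact: nsep.
apply/seteqP; split=> x.
  move=> [Sx|[[|l] /= li <-]]; [by left; left|by left; right|].
  by right; exists l.
move=> [[Sx|->]|[l li <-]]; [by left|by right; exists 0|].
by right; exists l.+1.
Qed.

(** * Enumeration of existential formulas with parameters *)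

(** These trees form a countable type, so injectivity of the code makes the formulas countable. *)
Fixpoint formula_code (n : nat) (phi : formula n) : GenTree.tree nat :=
  match phi with
  | Eq i j => GenTree.Node 0 [:: GenTree.Leaf (i : nat); GenTree.Leaf (j : nat)]
  | Adj i j =>
      GenTree.Node 1 [:: GenTree.Leaf (i : nat); GenTree.Leaf (j : nat)]
  | Not p => GenTree.Node 2 [:: formula_code p]
  | And p q => GenTree.Node 3 [:: formula_code p; formula_code q]
  | Ex p => GenTree.Node 4 [:: formula_code p]
  end.

Lemma formula_code_inj (n : nat) : injective (@formula_code n).
Proof.
move=> phi; elim: phi => {n} [n i j|n i j|n p IH|n p IHp q IHq|n p IH].
all: move=> [i' j'|i' j'|p'|p' q'|p'] //= [].
- by move=> /ord_inj -> /ord_inj ->.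
- by move=> /ord_inj -> /ord_inj ->.
- by move=> /IH ->.
- by move=> /IHp -> /IHq ->.
- by move=> /IH ->.
Qed.

(* A task asks for a witness of [Ex phi], the parameters being vertices already
   played by Separator, given by their round. *)
Definition task := {n : nat & (formula n.+1 * ('I_n -> nat))%type}.

Definition task_code (t : task) : nat * GenTree.tree nat * seq nat :=
  (tag t, formula_code (tagged t).1, [seq (tagged t).2 i | i : 'I_(tag t)]).

Lemma task_code_inj : injective task_code.
Proof.
move=> [n [p e]] [n' [p' e']] []; rewrite /= => nn'.
case: n' / nn' p' e' => p' e' /formula_code_inj -> ee'.
suff -> : e = e' by [].
apply/funext => i; have := congr1 (fun l => nth 0 l (enum_rank i)) ee'.
by rewrite !nth_image !enum_rankK.
Qed.

Lemma inj_unbounded (f : nat -> nat) (B : nat) :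
  injective f -> exists m, B <= f m.
Proof.
move=> finj; apply: contrapT => /forallNP H.
have fB m : f m < B by rewrite ltnNge; apply/negP/H.
pose g (i : 'I_B.+1) : 'I_B := Ordinal (fB i).
have ginj : injective g by move=> i j [] /finj/ord_inj.
by have := leq_card g ginj; rewrite !card_ord ltnn.
Qed.

(** Pairing each task with a counter makes it recur arbitrarily late, hence also after all its
    parameters have been played. *)
Lemma task_enum : exists en : nat -> option task,
  forall t B, exists2 i, B <= i & en i = Some t.
Proof.
pose decode x := if pselect (exists t, task_code t = x) is left H
                 then Some (sval (cid H)) else None.
have decodeK t : decode (task_code t) = Some t.
  rewrite /decode; case: pselect => [H|[]]; last by exists t.
  by congr Some; apply: task_code_inj; exact: (svalP (cid H)).
pose T := (nat * GenTree.tree nat * seq nat * nat)%type.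
exists (fun i => if unpickle i is Some x then decode (x : T).1 else None) => t B.
have [m Bm] : exists m, B <= pickle ((task_code t, m) : T).
  apply: inj_unbounded => m m' /(pcan_inj pickleK) [] //.
by exists (pickle ((task_code t, m) : T)) => //; rewrite pickleK decodeK.
Qed.

(** * The strategy of Separator *)

Definition witness (T : Type) (d : T) (P : T -> Prop) : T :=
  if pselect (exists x, P x) is left Px then sval (cid Px) else d.

Lemma witnessP (T : Type) (d : T) (P : T -> Prop) :
  (exists x, P x) -> P (witness d P).
Proof. by rewrite /witness; case: pselect => // Px _; exact: svalP. Qed.

Definition solves (G : graph) (s : nat -> G) (t : task) (x : G) : Prop :=
  sat (tagged t).1 (env_cons x (s \o (tagged t).2)).

(* The even rounds copy the vertices of Connector, the odd ones perform the
   tasks. *)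
Definition strategy (en : nat -> option task) (G : graph) (i : nat)
    (c s : nat -> G) : G :=
  if odd i then
    if en i./2 is Some t then
      witness (c 0) (fun x => (forall j, (tagged t).2 j < i) /\ solves s t x)
    else c 0
  else c i./2.

(** The bound on the parameters inside [witness] ensures that a task is attempted only when it
    refers to earlier rounds; otherwise the answer is [c 0]. *)
Lemma strategy_causal (en : nat -> option task) (G : graph) :
  causal (@strategy en G).
Proof.
move=> i c s c' s' cc' ss'.
have i2 : i./2 <= i by rewrite leq_half_double -addnn leqW ?leq_addr.
rewrite /strategy (cc' 0) // (cc' _ i2).
case: odd => //; case: en => // t; congr witness.
apply/funext => x; apply/propext.
have E : (forall j, (tagged t).2 j < i) -> s \o (tagged t).2 = s' \o (tagged t).2.
  by move=> ti; apply/funext => j; exact: ss'.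
by split=> -[ti]; rewrite /solves E.
Qed.

(** * The contradiction in an ultraproduct of counterexamples *)

Lemma finite_nat_bound (A : set nat) :
  finite_set A -> exists J, forall i, A i -> i < J.
Proof.
move=> /finite_seqP[l ->]; exists (\max_(i <- l) i).+1 => i /= il.
by rewrite ltnS; exact: leq_bigmax_seq.
Qed.

Theorem mainTheorem6 (r : nat) (C : graph -> Prop) :
  (forall M : graph, elementary_closure C M -> separable r M) ->
  exists k : nat, forall G : graph, C G -> separator_wins r k G.
Proof.
move=> sepC; apply: contrapT => nwins.
have Hk k : exists G, C G /\ ~ separator_wins r k.+2 G.
  apply: contrapT => /forallNP nG; apply: nwins; exists k.+2 => G CG.
  by apply: contrapT => nw; apply: (nG G).
have [en enP] := task_enum.
pose G k := sval (cid (Hk k)).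
have CG k : C (G k) := (svalP (cid (Hk k))).1.
have Pk k : exists p : (nat -> G k) * (nat -> G k) * G k,
    [/\ forall i, i <= k -> p.1.2 i = strategy en i p.1.1 p.1.2,
        forall i, i <= k -> ~ separated_over r (initial p.1.2 i) p.2 (p.1.1 i) &
        p.2 <> p.1.1 k].
  have := (svalP (cid (Hk k))).2.
  move=> /(connector_play (@strategy_causal en _))[c [s [w [_ sE nsep wc]]]].
  by exists (c, s, w); split=> // i /nsep; rewrite set0U.
pose c i k := (sval (cid (Pk k))).1.1 i.
pose s i k := (sval (cid (Pk k))).1.2 i.
pose w k := (sval (cid (Pk k))).2.
have sE i k : i <= k -> s i k = strategy en i (c^~ k) (s^~ k).
  by case: (svalP (cid (Pk k))) => H _ _; exact: H.
have nsep i k : i <= k -> ~ separated_over r (initial (s^~ k) i) (w k) (c i k).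
  by case: (svalP (cid (Pk k))) => _ H _; exact: H.
have wc k : w k <> c k k by case: (svalP (cid (Pk k))).
(* An ultrafilter containing all cofinal segments: each fixed round is eventually reached. *)
have [U [UU ooU]] := ultraFilterLemma eventually_filter.
have PU : ProperFilter U := ultra_proper.
have Uge m : U [set k | m <= k] by apply: ooU; exists m.
pose N := ultraproduct UU G.
pose cls : _ -> N := @ultra_class U G.
pose M := @induced N (fun x => exists i, x = cls (s i)).
have elM : elementary (@induced_val N _ : M -> N).
  apply: tarski_vaught => n phi e exN.
  have [idx idxE] := choice (fun j => svalP (e j)).
  have envE : @induced_val N _ \o e = cls \o (s \o idx).
    by apply/funext => j; exact: idxE.
  move: exN; rewrite envE => /(los UU (c 0) (Ex phi)) /= exk.
  (* The task is taken at an [i] beyond all parameter rounds, so its round [i.*2.+1] comes after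
     them. *)
  have [i Bi eni] := enP (existT _ n (phi, idx)) (\max_j idx j).+1.
  exists (exist _ (cls (s i.*2.+1)) (ex_intro _ _ erefl)).
  have -> : env_cons (cls (s i.*2.+1)) (cls \o (s \o idx)) =
      cls \o env_cons (s i.*2.+1) (s \o idx).
    by apply/funext => j; rewrite /= -env_cons_comp.
  apply/los; first exact: c 0.
  apply: filterS2 exk (Uge i.*2.+1) => k /= exk ik.
  have -> : (fun j => env_cons (s i.*2.+1) (s \o idx) j k) =
      env_cons (s i.*2.+1 k) (fun j => s (idx j) k).
    apply/funext => j.
    exact: (env_cons_comp (fun g : forall k, G k => g k)).
  rewrite (sE _ _ ik) /strategy /= odd_double /= uphalf_double eni.
  set P := (X in witness _ X); suff [] : P (witness (c 0 k) P) by [].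
  apply: witnessP; move: exk => [x px]; exists x; split=> // j /=.
  rewrite (leq_ltn_trans (leq_bigmax j)) // (leq_trans Bi) //.
  by rewrite -addnn leqW // leq_addr.
have closM : elementary_closure C M.
  move=> phi thphi; apply/elM.
  have -> : (fun i => @induced_val N _ (@no_var M i)) =
      cls \o @no_var (forall k, G k).
    by apply/funext => -[].
  apply/los; first exact: c 0.
  apply: filterS filterT => k _ /=.
  have -> : (fun i => @no_var (forall k, G k) i k) = @no_var (G k).
    by apply/funext => -[].
  exact: thphi.
(* If [w] had the class of [s i], then at some [k > i] the vertex [w k] would be among the first [k]
   vertices of Separator, hence separated over them from [c k k]. *)
have wM : ~ range (@induced_val N _ : M -> N) (cls w).
  move=> [x _ xw]; have [i xi] := svalP x.
  have /ultra_classP wi : cls w = cls (s i) by rewrite -xw -xi.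
  have [k [/= wk ik]] := filter_ex (filterI wi (Uge i.+1)).
  apply: (nsep k k (leqnn k)); apply: separated_over_mem (wc k).
  by exists i.
have [S [finS [F HF]]] := sepC M closM N _ elM _ wM.
have [idx idxE] := choice (fun x : M => svalP x).
have [J JP] := finite_nat_bound (finite_image idx finS).
have SJ : @induced_val N _ @` S `<=` @initial N (cls \o s) J.
  move=> _ [x Sx <-]; exists (idx x); first by apply: JP; exists x.
  exact/esym/idxE.
(* Round [J.*2] copies [c J], so the class of [c J] lies in [M]; and [w k] survives round [J], which
   is played over exactly the first [J] vertices of Separator. *)
pose u : M := exist _ (cls (s J.*2)) (ex_intro _ _ erefl).
have uE : induced_val u = cls (c J).
  apply/ultra_classP; apply: filterS (Uge J.*2) => k /= /sE ->.
  by rewrite /strategy odd_double doubleK.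
move: (HF u); rewrite uE; apply: not_separated_ultra SJ _.
by apply: filterS (Uge J) => k /= /nsep.
Qed.
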